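(* Assume conditions (C1), (C2), (C3) listed in the context, with $\nu\in[0,\infty)$ the constant appearing in (C2). Then the Galton--Watson process in varying environment $(X_n)$, conditioned on non-extinction, satisfies \[ \mathcal{L}(X_n \mid X_n>0)\ \longrightarrow\ \mathrm{Geom}\left(\frac{2}{2+\nu}\right)\qquad\text{in distribution as } n\to\infty . \] (For $\nu=0$ the limit is the law degenerate at $1$.)
   Context: Let $\mathbb{N}=\{1,2,\ldots\}$. Let $\{\xi_{n,j}\}_{n,j\in\mathbb{N}}$ be independent nonnegative integer-valued random variables such that for each $n$ the variables $\xi_n,\xi_{n,1},\xi_{n,2},\ldots$ are identically distributed. Define $X_0=1$ and $X_n=\sum_{j=1}^{X_{n-1}}\xi_{n,j}$ for $n\in\mathbb{N}$. Let $f_n(s)=\mathbf{E}\,s^{\xi_n}$, $s\in[0,1]$, be the offspring generating function of generation $n$, and $\overline{f}_n=f_n'(1)=\mathbf{E}\,\xi_n$ the offspring mean; $f_n''(1)=\mathbf{E}[\xi_n(\xi_n-1)]$ and $f_n'''(1)=\mathbf{E}[\xi_n(\xi_n-1)(\xi_n-2)]$ are the second and third factorial moments. It is assumed that $\overline{f}_n>0$ for all $n$, so that $\mathbf{P}(X_n>0)>0$ for all $n$. Conditions: (C1) $\overline{f}_n<1$ for all $n$, $\lim_{n\to\infty}\overline{f}_n=1$, and $\sum_{n=1}^\infty(1-\overline{f}_n)=\infty$. (C2) $\lim_{n\to\infty}\frac{f_n''(1)}{1-\overline{f}_n}=\nu\in[0,\infty)$. (C3) if $\nu>0$, then $\lim_{n\to\infty}\frac{f_n'''(1)}{1-\overline{f}_n}=0$.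 $\mathcal{L}(X_n\mid X_n>0)$ denotes the law of $X_n$ conditioned on $\{X_n>0\}$. For $p\in(0,1]$, $\mathrm{Geom}(p)$ is the law of a random variable $V$ with $\mathbf{P}(V=k)=(1-p)^{k-1}p$, $k=1,2,\ldots$. *)

(* Defs.v *)
From HB Require Import structures.
From mathcomp Require Import all_boot all_order all_algebra.
From mathcomp Require Import all_classical all_reals all_analysis.

Set Implicit Arguments.
Unset Strict Implicit.
Unset Printing Implicit Defensive.
Import Order.TTheory GRing.Theory Num.Theory.
Import numFieldNormedType.Exports.
Local Open Scope classical_set_scope.
Local Open Scope ring_scope.

Definition mutually_independent (d d' : measure_display)
    (T : measurableType d) (T' : measurableType d') (R : realType)
    (P : probability T R) (I : choiceType) (D : set I)
    (X : I -> {RV P >-> T'}) : Prop :=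
  forall s : seq I, uniq s -> [set` s] `<=` D ->
  forall A : I -> set T', (forall i, measurable (A i)) ->
  P (\bigcap_(i in [set` s]) (X i @^-1` A i)) =
  (\prod_(i <- s) P (X i @^-1` A i))%E.
Arguments mutually_independent {d d' T T' R} P {I} D X.

Definition mean (d : measure_display) (T : measurableType d) (R : realType)
    (P : probability T R) (X : {RV P >-> nat}) : \bar R :=
  'E_P[fun w => (X w)%:R].
Arguments mean {d T R} P X.

(* The expectation of the falling factorial X (X - 1) ... (X - r + 1), in
   [0, +oo]; it is the r-th (left) derivative at 1 of the generating function
   s |-> E[s ^ X]. *)
Definition factorial_moment (d : measure_display) (T : measurableType d)
    (R : realType) (P : probability T R) (X : {RV P >-> nat}) (r : nat) :
    \bar R :=
  'E_P[fun w => ((X w) ^_ r)%:R].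
Arguments factorial_moment {d T R} P X r.

(* Generations and individuals are numbered from 1; the values of xi at an
   index 0 are never used. *)
Fixpoint gw (T : Type) (xi : nat -> nat -> T -> nat) (n : nat) (w : T) : nat :=
  if n is m.+1 then (\sum_(1 <= j < (gw xi m w).+1) xi n j w)%N else 1%N.

Section gw_measurable.
Context d (T : measurableType d) (R : realType) (P : probability T R).
Variable xi : nat -> nat -> {RV P >-> nat}.

Lemma measurable_fun_natP (f : T -> nat) :
  (forall k, measurable [set w | f w = k]) -> measurable_fun setT f.
Proof.
move=> mf _ Y _; rewrite setTI.
have -> : f @^-1` Y = \bigcup_(k in Y) [set w | f w = k].
  apply/seteqP; split=> [w /= Yw|w [k Yk /= fk]].
    by exists (f w).
  by rewrite fk.
by apply: bigcup_measurable => k _; exact: mf.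
Qed.

Lemma measurable_nat_eq (f : T -> nat) k :
  measurable_fun setT f -> measurable [set w | f w = k].
Proof.
by move=> /(_ measurableT [set k] I); rewrite setTI.
Qed.

Lemma measurable_fun_natD (f g : T -> nat) :
  measurable_fun setT f -> measurable_fun setT g ->
  measurable_fun setT (fun w => f w + g w)%N.
Proof.
move=> mf mg; apply: measurable_fun_natP => k.
have -> : [set w | (f w + g w)%N = k] =
    \bigcup_i \bigcup_(j in [set j | (i + j)%N = k])
      ([set w | f w = i] `&` [set w | g w = j]).
  apply/seteqP; split=> [w /= fg|w [i _ [j /= ij [/= fi gj]]]].
    by exists (f w) => //; exists (g w).
  by rewrite fi gj.
apply: bigcup_measurable => i _; apply: bigcup_measurable => j _.
by apply: measurableI; exact: measurable_nat_eq.
Qed.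

Lemma measurable_gw n : measurable_fun setT (gw xi n).
Proof.
elim: n => [|n IH]; first exact: measurable_cst.
apply: measurable_fun_natP => k.
have -> : [set w | gw xi n.+1 w = k] =
    \bigcup_m ([set w | gw xi n w = m] `&`
               [set w | (\sum_(1 <= j < m.+1) xi n.+1 j w)%N = k]).
  apply/seteqP; split=> [w /= gk|w [m _ [/= -> ]]//].
  by exists (gw xi n w).
apply: bigcup_measurable => m _; apply: measurableI.
  exact: measurable_nat_eq.
apply: measurable_nat_eq; elim: (index_iota _ _) => [|j s IHs].
  by under eq_fun do rewrite big_nil; exact: measurable_cst.
under eq_fun do rewrite big_cons.
by apply: measurable_fun_natD => //; exact: measurable_funPT.
Qed.

HB.instance Definition _ n := isMeasurableFun.Build _ _ _ _ (gw xi n)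
  (measurable_gw n).

End gw_measurable.

Section conditioning.
Context d d' (T : measurableType d) (T' : measurableType d') (R : realType).
Variable P : probability T R.

(* P( . | E); by convention of mnormalize this is P itself when P E = 0. *)
Definition cond_prob (E : set T) (mE : measurable E) : probability T R :=
  mnormalize (mrestr P mE) P.

Lemma cond_probE (E : set T) (mE : measurable E) (A : set T) :
  (0 < P E)%E -> cond_prob mE A = (P (A `&` E) / P E)%E.
Proof.
move=> PE0; rewrite /cond_prob /= /mnormalize /= /mrestr setTI.
have PEfin := fin_num_measure P E mE.
rewrite gt_eqF//= lt_eqF ?ltey_eq ?PEfin//=.
by rewrite -[in RHS](fineK PEfin) inver gt_eqF// fine_gt0// PE0 ltey_eq PEfin.
Qed.

Lemma measurable_pos (X : {RV P >-> nat}) : measurable [set w | (0 < X w)%N].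
Proof. exact: (@measurable_funPTI _ _ _ _ X [set k | (0 < k)%N]). Qed.

(* The law of X under P( . | X > 0). *)
Definition cond_law_pos (X : {RV P >-> nat}) : probability nat R :=
  distribution (cond_prob (measurable_pos X)) X.

End conditioning.
Arguments cond_law_pos {d T R} P X.

Section geometric_law.
Context {R : realType}.

Definition geometric_pmf (p : R) (k : nat) : R :=
  if k is j.+1 then (1 - p) ^+ j * p else 0.

Lemma geometric_pmf_ge0 p k : 0 < p <= 1 -> 0 <= geometric_pmf p k.
Proof.
move=> /andP[p0 p1]; case: k => //= k.
by apply: mulr_ge0; [rewrite exprn_ge0// subr_ge0|exact: ltW].
Qed.

Variable p : R.
Local Open Scope ereal_scope.

(* Outside of 0 < p <= 1 this is the Dirac mass at 1, by convention. *)
Definition geometric_prob (U : set nat) : \bar R :=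
  if (0 < p <= 1)%R then \esum_(k in U) (geometric_pmf p k)%:E
  else \d_1%N U.

Let geometric0 : geometric_prob set0 = 0.
Proof.
by rewrite /geometric_prob measure0; case: ifPn => //; rewrite esum_set0.
Qed.

Let geometric_ge0 U : 0 <= geometric_prob U.
Proof.
rewrite /geometric_prob; case: ifPn => // p01; apply: esum_ge0 => /= n _.
by rewrite lee_fin geometric_pmf_ge0.
Qed.

Let geometric_sigma_additive : semi_sigma_additive geometric_prob.
Proof.
move=> F mF tF mUF; rewrite /geometric_prob; case: ifPn => p01; last first.
  exact: measure_semi_sigma_additive.
apply: cvg_toP.
  apply: ereal_nondecreasing_is_cvgn => a b ab.
  apply: lee_sum_nneg_natr => // n _ _.
  by apply: esum_ge0 => /= k _; rewrite lee_fin geometric_pmf_ge0.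
by rewrite nneseries_sum_bigcup// => i; rewrite lee_fin geometric_pmf_ge0.
Qed.

HB.instance Definition _ := isMeasure.Build _ _ _ geometric_prob
  geometric0 geometric_ge0 geometric_sigma_additive.

Let geometric_setT : geometric_prob [set: nat] = 1.
Proof.
rewrite /geometric_prob; case: ifPn => [p01|_]; last by rewrite diracT.
have pmf0 k : 0 <= (geometric_pmf p k)%:E by rewrite lee_fin geometric_pmf_ge0.
move: (p01) => /andP[p0 p1].
rewrite -nneseries_esumT//.
apply/cvg_lim => //; rewrite -cvg_shiftS /=.
rewrite [X in X @ _ --> _](_ : _ =
    EFin \o (series (geometric p (1 - p)%R))); last first.
  apply/funext => n /=; rewrite /series /= -sumEFin big_nat_recl//= add0e.
  by apply: eq_bigr => i _; rewrite mulrC.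
apply: cvg_EFin; first by near=> n.
have q1 : (`|1 - p| < 1)%R by rewrite ger0_norm ?subr_ge0// gtrBl.
by have := @cvg_geometric_series R p _ q1; rewrite subKr divff// gt_eqF.
Unshelve. all: by end_near. Qed.

HB.instance Definition _ :=
  @Measure_isProbability.Build _ _ R geometric_prob geometric_setT.

End geometric_law.

Definition weak_cvg (R : realType)
    (mu : nat -> probability (measurableTypeR R) R)
    (nu : probability (measurableTypeR R) R) : Prop :=
  forall f : R -> R, continuous f -> bounded_fun (f : R -> R^o) ->
  (\int[mu n]_x (f x)%:E)%E @[n --> \oo] --> (\int[nu]_x (f x)%:E)%E.

Definition natr_fun {R : realType} (k : nat) : measurableTypeR R := k%:R.

Lemma measurable_natr_fun (R : realType) :
  measurable_fun setT (@natr_fun R).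
Proof. by []. Qed.

HB.instance Definition _ (R : realType) :=
  isMeasurableFun.Build _ _ _ _ (@natr_fun R) (@measurable_natr_fun R).

Definition real_law (R : realType) (mu : probability nat R) :
    probability (measurableTypeR R) R :=
  distribution mu (@natr_fun R).

(* Main.v *)
(* Let h_n(x) = 1 - f_n(1 - x), a_n the mean of f_n and v = nu / 2.  The moment
   conditions give h_n(x) = a_n x - (v + o(1)) (1 - a_n) x^2 uniformly in x, so
   that 1 / h_n(x) + v = (1 / x + v) / a_n + o(1) (1 / a_n - 1).  The constants
   w = v +- e make this an inequality 1 / h_n(x) + w <= (1 / x + w) / a_n (or >=)
   that composes without accumulating errors: as a_1 ... a_n -> 0, it yields
     a_1 ... a_n / h_1(... h_n(x)) -> 1 / x + v.
   Finitely many early generations, which may have infinite second moment, are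
   harmless since h_k(x) / x -> a_k as x -> 0.  The generating function of X_n
   given X_n > 0 is 1 - h_1(... h_n(1 - s)) / h_1(... h_n(1)); its limit
     1 - (1 + v) / (1 / (1 - s) + v)
   is that of the geometric law. *)

Require Import Defs.
From mathcomp Require Import all_boot all_order all_algebra.
From mathcomp Require Import all_classical all_reals all_analysis.
From mathcomp Require Import measurable_realfun.
From mathcomp Require Import ring lra.
Import Order.TTheory GRing.Theory Num.Theory.
Import numFieldNormedType.Exports.
Local Open Scope classical_set_scope.
Local Open Scope ring_scope.

Set Implicit Arguments.
Unset Strict Implicit.
Unset Printing Implicit Defensive.

(** * Composition of nearly affine maps *)

Section iteration.
Context {R : realType}.
Implicit Types (a : nat -> R) (h : nat -> R -> R) (x y v w e : R).

(* In the coordinate [1 / x], [h] is compared with the affine map of slope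
   [1 / a] fixing [- w]. *)
Lemma inv_add_le (a h : R) x w e : 0 < a < 1 -> 0 < x <= 1 -> 0 < h -> 0 <= w ->
  0 <= e -> e + e * w * (1 - a) <= a * w ->
  a * x - e * (1 - a) * x ^+ 2 <= h ->
  h^-1 + w <= (x^-1 + w) / a.
Proof.
move=> /andP[a0 a1] /andP[x0 x1] h0 w0 e0 slack hge.
have ai0 : 0 < a^-1 by rewrite invr_gt0.
rewrite -(ler_pM2l a0) -(ler_pM2l h0) -(ler_pM2l x0).
have -> : x * (h * (a * (h^-1 + w))) = a * x * (1 + h * w).
  by field; rewrite gt_eqF.
have -> : x * (h * (a * ((x^-1 + w) / a))) = h * (1 + x * w).
  by field; rewrite !gt_eqF.
suff : a * x <= h * (1 + w * (1 - a) * x) by lra.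
have p0 : 0 <= 1 + w * (1 - a) * x.
  by rewrite addr_ge0 ?mulr_ge0 ?subr_ge0//; lra.
apply: le_trans (ler_wpM2r p0 hge).
(* Inserting the lower bound for [h] and cancelling [a * x] leaves this product; its last factor is
   smallest at [x = 1], where [slack] makes it nonnegative. *)
have : 0 <= (1 - a) * x ^+ 2 * (a * w - e - e * w * (1 - a) * x).
  apply: mulr_ge0; first by rewrite mulr_ge0 ?sqr_ge0//; lra.
  have : e * w * (1 - a) * x <= e * w * (1 - a) * 1.
    by apply: ler_wpM2l => //; rewrite !mulr_ge0//; lra.
  lra.
lra.
Qed.

Lemma inv_add_ge (a h : R) x w : 0 < a < 1 -> 0 < x <= 1 -> 0 < h ->
  h <= a * x -> h <= a * x - w * (1 - a) * x ^+ 2 ->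
  (x^-1 + w) / a <= h^-1 + w.
Proof.
move=> /andP[a0 a1] /andP[x0 x1] h0 hle1 hle2.
rewrite -(ler_pM2l a0) -(ler_pM2l h0) -(ler_pM2l x0).
have -> : x * (h * (a * (h^-1 + w))) = a * x * (1 + h * w).
  by field; rewrite gt_eqF.
have -> : x * (h * (a * ((x^-1 + w) / a))) = h * (1 + x * w).
  by field; rewrite !gt_eqF.
suff : h * (1 + w * (1 - a) * x) <= a * x by lra.
have d0 : 0 <= (1 - a) * x by rewrite mulr_ge0//; lra.
(* [w] will be [v - e], which may be negative; the linear bound on [h] then suffices, and [w > 0]
   calls for the quadratic one. *)
have [w0|w0] := leP w 0.
  apply: le_trans hle1; rewrite -[leRHS]mulr1; apply: ler_wpM2l; first lra.
  have : w * ((1 - a) * x) <= 0 by rewrite mulr_le0_ge0.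
  lra.
have p0 : 0 <= 1 + w * (1 - a) * x.
  by rewrite -mulrA; have := mulr_ge0 (ltW w0) d0; lra.
apply: (le_trans (ler_wpM2r p0 hle2)).
have : 0 <= w * ((1 - a) * x) * (x * (1 - a)  * (1 + w * x)).
  by rewrite !mulr_ge0//; [lra..|have := mulr_gt0 w0 x0; lra].
lra.
Qed.

(* [hcomp h j m] is the composition of [h j.+1], ..., [h (j + m)], the last of
   them being applied first. *)
Fixpoint hcomp h (j m : nat) (x : R) : R :=
  if m is m'.+1 then h j.+1 (hcomp h j.+1 m' x) else x.

(** [hcomp] unfolds at its outermost map, but a new generation of the process enters innermost. *)
Lemma hcompSr h j m x : hcomp h j m.+1 x = hcomp h j m (h (j + m).+1 x).
Proof.
elim: m j x => [|m IH] j x; first by rewrite addn0.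
by rewrite [LHS]/= -/(hcomp h j.+1 m.+1 x) IH /= addSnnS.
Qed.

Lemma prodS a j m : \prod_(j <= k < j + m.+1) a k.+1 =
  a j.+1 * \prod_(j.+1 <= k < j.+1 + m) a k.+1.
Proof. by rewrite big_ltn ?addSnnS// addnS ltnS leq_addr. Qed.

Section bounds.
Variables (a : nat -> R) (h : nat -> R -> R).
Hypothesis a01 : forall n, (0 < n)%N -> 0 < a n < 1.
Hypothesis h01 : forall n x, (0 < n)%N -> 0 < x <= 1 -> 0 < h n x <= 1.

Lemma hcomp01 j m x : 0 < x <= 1 -> 0 < hcomp h j m x <= 1.
Proof. by move=> x01; elim: m j => //= m IH j; exact: h01. Qed.

Lemma prod_gt0 j m : 0 < \prod_(j <= k < j + m) a k.+1.
Proof. by apply: prodr_gt0 => k _; have /andP[] := a01 (isT : (0 < k.+1)%N). Qed.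

(** The one-step bounds share the fixed point [- w]: after translation by [w] they are
    multiplications by [1 / a n], and only the slopes multiply. *)
Lemma hcomp_inv_le N w m x : 0 < x <= 1 ->
  (forall n y, (N < n)%N -> 0 < y <= 1 -> (h n y)^-1 + w <= (y^-1 + w) / a n) ->
  (hcomp h N m x)^-1 + w <= (x^-1 + w) / \prod_(N <= k < N + m) a k.+1.
Proof.
move=> x01; elim: m N => [|m IH] N hN.
  by rewrite addn0 big_geq// divr1.
rewrite prodS /= invfM mulrA; apply: (le_trans (hN _ _ _ _)) => //.
  exact: hcomp01.
rewrite mulrAC ler_wpM2r//.
  by rewrite invr_ge0 ltW//; have /andP[] := a01 (isT : (0 < N.+1)%N).
by apply: IH => n y Nn; apply: hN; exact: ltnW.
Qed.

Lemma hcomp_inv_ge N w m x : 0 < x <= 1 ->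
  (forall n y, (N < n)%N -> 0 < y <= 1 -> (y^-1 + w) / a n <= (h n y)^-1 + w) ->
  (x^-1 + w) / \prod_(N <= k < N + m) a k.+1 <= (hcomp h N m x)^-1 + w.
Proof.
move=> x01; elim: m N => [|m IH] N hN.
  by rewrite addn0 big_geq// divr1.
rewrite prodS /= invfM mulrA; apply: (le_trans _ (hN _ _ _ _)) => //; last first.
  exact: hcomp01.
rewrite mulrAC ler_wpM2r//.
  by rewrite invr_ge0 ltW//; have /andP[] := a01 (isT : (0 < N.+1)%N).
by apply: IH => n y Nn; apply: hN; exact: ltnW.
Qed.

Hypothesis h_le : forall n x, (0 < n)%N -> 0 < x <= 1 -> h n x <= a n * x.

Lemma hcomp_le j m x : 0 < x <= 1 ->
  hcomp h j m x <= \prod_(j <= k < j + m) a k.+1 * x.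
Proof.
move=> x01; elim: m j => [|m IH] j; first by rewrite addn0 big_geq// mul1r.
rewrite prodS /=; apply: (le_trans (h_le _ _)) => //; first exact: hcomp01.
rewrite -mulrA ler_wpM2l//; by have /andP[/ltW] := a01 (isT : (0 < j.+1)%N).
Qed.

End bounds.
End iteration.

(** * Limit of the rescaled composition *)

Section iteration_limit.
Context {R : realType}.
Variables (a : nat -> R) (h : nat -> R -> R) (v : R).
Hypothesis a01 : forall n, (0 < n)%N -> 0 < a n < 1.
Hypothesis h01 : forall n (x : R), (0 < n)%N -> 0 < x <= 1 -> 0 < h n x <= 1.
Hypothesis h_le : forall n (x : R), (0 < n)%N -> 0 < x <= 1 -> h n x <= a n * x.
Hypothesis h_deriv0 : forall n (y : nat -> R), (0 < n)%N ->
  (forall m, 0 < y m <= 1) -> y @ \oo --> (0 : R) ->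
  (fun m => h n (y m) / y m) @ \oo --> a n.
Hypothesis v_ge0 : 0 <= v.
Hypothesis h_expand : forall e : R, 0 < e -> \forall n \near \oo,
  forall x : R, 0 < x <= 1 ->
  `|h n x - a n * x + v * (1 - a n) * x ^+ 2| <= e * (1 - a n) * x ^+ 2.
Hypothesis a_cvg1 : a @ \oo --> (1 : R).
Hypothesis prod_cvg0 : (fun n => \prod_(0 <= k < n) a k.+1) @ \oo --> (0 : R).

Lemma prod_shift_cvg0 j :
  (fun m => \prod_(j <= k < j + m) a k.+1) @ \oo --> (0 : R).
Proof.
have -> : (fun m => \prod_(j <= k < j + m) a k.+1) =
    (fun m => (\prod_(0 <= k < j) a k.+1)^-1 * \prod_(0 <= k < m + j) a k.+1).
  apply/funext => m.
  rewrite [X in _ = _ * X](big_cat_nat (n := j)) ?leq_addl//= mulKf 1?addnC//.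
  by rewrite gt_eqF//; have := prod_gt0 a01 0 j.
rewrite -(mulr0 (\prod_(0 <= k < j) a k.+1)^-1); apply: cvgMl_tmp.
by rewrite (cvg_shiftn j (fun m => \prod_(0 <= k < m) a k.+1)).
Qed.

Lemma h_inv_near (e : R) : 0 < e ->
  exists N, forall n (x : R), (N < n)%N -> 0 < x <= 1 ->
  (h n x)^-1 + (v + e) <= (x^-1 + (v + e)) / a n /\
  (x^-1 + (v - e)) / a n <= (h n x)^-1 + (v - e).
Proof.
move=> e0; have e20 : 0 < e / 2 by lra.
(* Half of [e] absorbs the error of the expansion; the other half is the limit of the difference of
   the two sides here, as [a n] tends to 1. *)
have slack : \forall n \near \oo,
    v + e / 2 + (v + e / 2) * (v + e) * (1 - a n) <= a n * (v + e).
  pose f n := a n * (v + e) - (v + e / 2 + (v + e / 2) * (v + e) * (1 - a n)).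
  have fcvg : f @ \oo --> 1 * (v + e) -
      (v + e / 2 + (v + e / 2) * (v + e) * (1 - 1)).
    apply: cvgB; first by apply: cvgMr_tmp.
    apply: cvgD; first exact: cvg_cst.
    by apply: cvgMl_tmp; apply: cvgB => //; exact: cvg_cst.
  have : \forall n \near \oo, 0 < f n.
    apply: (cvgr_gt _ fcvg); lra.
  by apply: filterS => n; rewrite /f; lra.
have [N _ hN] : \forall n \near \oo, (v + e / 2 +
    (v + e / 2) * (v + e) * (1 - a n) <= a n * (v + e)) /\
    forall x : R, 0 < x <= 1 ->
    `|h n x - a n * x + v * (1 - a n) * x ^+ 2| <= e / 2 * (1 - a n) * x ^+ 2.
  by near=> n; split; near: n => //; exact: h_expand.
exists N => n x Nn x01; have [sl he] := hN n (ltnW Nn).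
have n0 : (0 < n)%N by exact: leq_ltn_trans Nn.
have /andP[h0 h1] := h01 n0 x01; have a01n := a01 n0.
have := he x x01; rewrite ler_norml => /andP[hge hle].
have d0 : 0 <= e / 2 * (1 - a n) * x ^+ 2.
  by rewrite !mulr_ge0 ?sqr_ge0//; lra.
split.
  by apply: (@inv_add_le _ _ _ _ _ (v + e / 2)) => //; rewrite ?addr_ge0 ?(ltW e0) ?(ltW e20)//; lra.
by apply: inv_add_ge => //; [exact: h_le|lra].
Unshelve. all: by end_near. Qed.

Variable x : R.
Hypothesis x01 : 0 < x <= 1.

Lemma hcomp_cvg0 j : (fun m => hcomp h j m x) @ \oo --> (0 : R).
Proof.
apply: (@squeeze_cvgr _ _ _ _ (cst 0)
  (fun m => \prod_(j <= k < j + m) a k.+1 * x)).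
- near=> m; rewrite (hcomp_le a01)// andbT /=.
  by have /andP[/ltW] := hcomp01 h01 j m x01.
- exact: cvg_cst.
- by rewrite -(mul0r x); apply: cvgMr_tmp; exact: prod_shift_cvg0.
Unshelve. all: by end_near. Qed.

(** [A 0 m] is the sequence whose limit is sought; [A N m] is its analogue with the first [N]
    generations removed. *)
Let A j m := (\prod_(j <= k < j + m) a k.+1) / hcomp h j m x.

Let A_gt0 j m : 0 < A j m.
Proof.
by rewrite divr_gt0// ?prod_gt0//; have /andP[] := hcomp01 h01 j m x01.
Qed.

(** The ratio is [a j.+1] times [y / h j.+1 y] at [y = hcomp h j.+1 m x], and this [y] tends to 0,
    where [h j.+1] has slope [a j.+1]. *)
Let A_step j : (fun m => A j m.+1 / A j.+1 m) @ \oo --> (1 : R).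
Proof.
have an0 : a j.+1 != 0 by rewrite gt_eqF//; have /andP[] := a01 (isT : (0 < j.+1)%N).
have y01 m : 0 < hcomp h j.+1 m x <= 1 by exact: hcomp01.
have := h_deriv0 (isT : (0 < j.+1)%N) y01 (hcomp_cvg0 _).
move=> /(cvgV an0) /(cvgM (cvg_cst (a j.+1))); rewrite divff//.
apply: cvg_trans; apply: near_eq_cvg; near=> m.
rewrite /A prodS /=.
have /andP[y0 _] := y01 m; have /andP[hy0 _] := h01 (isT : (0 < j.+1)%N) (y01 m).
by have p0 := prod_gt0 a01 j.+1 m; field; rewrite !gt_eqF.
Unshelve. all: by end_near. Qed.

(* Each of the first [N] generations is asymptotically linear at 0. *)
Let A_ratio N : (fun m => A 0 (N + m) / A N m) @ \oo --> (1 : R).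
Proof.
elim: N => [|N IH].
  by under eq_fun do rewrite add0n divff ?gt_eqF//; exact: cvg_cst.
move: IH; rewrite -(cvg_shiftn 1 (fun m => A 0 (N + m) / A N m)) => IH.
have -> : (fun m => A 0 (N.+1 + m) / A N.+1 m) =
    (fun m => A 0 (N + (m + 1)) / A N (m + 1) * (A N m.+1 / A N.+1 m)).
  apply/funext => m; by rewrite addn1 addnS -addSn mulrA divfK// gt_eqF.
by rewrite -[X in _ --> X]mulr1; exact: cvgM IH (A_step N).
Qed.

(** Beyond a suitable [N] the one-step bounds hold with [w = v + e / 2] and [w = v - e / 2].
    Multiplied by the product [p] of the means, they enclose [A N m] up to a term [w * p], which
    vanishes in the limit. *)
Let A_near (e : R) : 0 < e -> exists N, \forall m \near \oo,
  `|A N m - (x^-1 + v)| <= e.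
Proof.
move=> e0; have e20 : 0 < e / 2 by lra.
have [N hN] := h_inv_near e20; exists N.
have pN : \forall m \near \oo, v * \prod_(N <= k < N + m) a k.+1 <= e / 2.
  apply: (cvgr_le (0 : R)); last lra.
  by rewrite -(mulr0 v); apply: cvgMl_tmp; exact: prod_shift_cvg0.
near=> m; have p0 := prod_gt0 a01 N m.
have pm : v * \prod_(N <= k < N + m) a k.+1 <= e / 2 by near: m.
have := @hcomp_inv_le _ _ _ a01 h01 N (v + e / 2) m x x01
  (fun n y Nn y01 => (hN n y Nn y01).1).
have := @hcomp_inv_ge _ _ _ a01 h01 N (v - e / 2) m x x01
  (fun n y Nn y01 => (hN n y Nn y01).2).
rewrite /A; move: p0 pm; set p := \prod_(N <= k < N + m) _ => p0 pm.
rewrite ler_pdivrMr// ler_pdivlMr// ![(_ + _) * p]mulrDl [_^-1 * p]mulrC => lo up.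
have ve : 0 <= (v + e / 2) * p by rewrite mulr_ge0 ?addr_ge0 ?(ltW e20) ?(ltW p0).
have pe : 0 <= e / 2 * p by rewrite mulr_ge0 ?(ltW e20) ?(ltW p0).
rewrite ler_norml; apply/andP; split; lra.
Unshelve. all: by end_near. Qed.

Lemma prod_div_hcomp_cvg :
  (fun n => (\prod_(0 <= k < n) a k.+1) / hcomp h 0 n x) @ \oo --> x^-1 + v.
Proof.
apply/cvgrPdist_le => e e0; have e20 : 0 < e / 2 by lra.
have [N AN] := A_near e20.
have L0 : 0 < x^-1 + v by have /andP[? _] := x01; rewrite ltr_wpDr// invr_gt0.
have B0 : 0 < x^-1 + v + e / 2 by lra.
(* The relative error of [A 0 (N + m)] gets multiplied by [A N m], which is at most
   [x^-1 + v + e / 2]; hence this tolerance. *)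
have F1 : \forall m \near \oo,
    `|A 0 (N + m) / A N m - 1| <= e / 2 / (x^-1 + v + e / 2).
  by have := cvgr_distC_le _ _ (A_ratio N); apply; rewrite divr_gt0.
have : \forall m \near \oo, `|x^-1 + v - A 0 (m + N)| <= e.
  apply: filterS2 AN F1 => m AL; rewrite ler_pdivlMr// [(m + N)%N]addnC => FA.
  have Ale : A N m <= x^-1 + v + e / 2 by move: AL; rewrite ler_norml; lra.
  have -> : x^-1 + v - A 0 (N + m) =
      - (A 0 (N + m) / A N m - 1) * A N m - (A N m - (x^-1 + v)).
    by field; rewrite !gt_eqF//; have /andP[] := x01.
  rewrite (le_trans (ler_normB _ _))// (splitr e) lerD//.
  rewrite normrM normrN (le_trans _ FA)// ler_wpM2l//.
  by rewrite ger0_norm// ltW.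
move=> [M _ hM]; exists (M + N)%N => // n /= Mn.
have Nn : (N <= n)%N by rewrite (leq_trans _ Mn)// leq_addl.
have := hM (n - N)%N; rewrite /= subnK// /A add0n; apply.
by rewrite leq_subRL// addnC.
Qed.

End iteration_limit.

(** * Laws on the natural numbers *)

Lemma ge0_integral_setI_level d (T : measurableType d) (R : realType)
    (mu : {measure set T -> \bar R}) (D : set T) (X : T -> nat) (f : T -> \bar R) :
  measurable D -> measurable_fun [set: T] X -> measurable_fun [set: T] f ->
  (forall w, 0 <= f w)%E ->
  (\int[mu]_(w in D) f w =
   \sum_(k <oo) \int[mu]_(w in D `&` [set w | X w = k]) f w)%E.
Proof.
move=> mD mX mf f0.
have DE : D = \bigcup_k (D `&` [set w | X w = k]).
  by apply/seteqP; split=> [w Dw|w [k _ []]//]; exists (X w).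
rewrite [X in (\int[_]_(_ in X) _)%E]DE ge0_integral_bigcup//.
- by move=> k; apply: measurableI => //; exact: measurable_nat_eq.
- by apply: measurable_funS mf.
- by move=> i j _ _ [w [[_ /= <-] [_ /= <-]]].
Qed.

Lemma integral_setI_level d (T : measurableType d) (R : realType)
    (mu : {measure set T -> \bar R}) (D : set T) (X : T -> nat) (g : nat -> R) k :
  measurable D -> measurable_fun [set: T] X ->
  (\int[mu]_(w in D `&` [set w | X w = k]) (g (X w))%:E =
   (g k)%:E * mu (D `&` [set w | X w = k]))%E.
Proof.
move=> mD mX; rewrite -integral_cst; last first.
  by apply: measurableI => //; exact: measurable_nat_eq.
by apply: eq_integral => w; rewrite inE => -[_ /= ->].
Qed.

Lemma measurable_fun_nat_comp d (T : measurableType d) (R : realType)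
    (X : T -> nat) (g : nat -> R) :
  measurable_fun [set: T] X -> measurable_fun [set: T] (fun w => (g (X w))%:E).
Proof. by move=> mX; apply/measurable_EFinP; exact: (measurableT_comp _ mX). Qed.

(** * Point masses and integrals of bounded functions *)

Section nat_law.
Context {R : realType}.
Implicit Types (mu : probability nat R) (g : nat -> R) (s : R).

Definition pmf mu k : R := fine (mu [set k]).

Lemma pmfE mu k : (pmf mu k)%:E = mu [set k].
Proof. by rewrite fineK// fin_num_measure. Qed.

Lemma pmf_ge0 mu k : 0 <= pmf mu k.
Proof. exact: fine_ge0. Qed.

Lemma integral_nat_set1 mu g k :
  (\int[mu]_(j in [set k]) (g j)%:E = (g k * pmf mu k)%:E)%E.
Proof.
rewrite EFinM pmfE -integral_cst//.
by apply: eq_integral => j; rewrite inE => ->.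
Qed.

Lemma ge0_integral_nat mu g : (forall k, 0 <= g k) ->
  (\int[mu]_k (g k)%:E = \sum_(k <oo) (g k * pmf mu k)%:E)%E.
Proof.
move=> g0; rewrite (@ge0_integral_setI_level _ _ _ _ setT id)//.
by apply: eq_eseriesr => k _; rewrite setTI -integral_nat_set1.
Qed.

(** A form of Fatou's lemma for varying laws: a finite partial sum already exceeds [c], and finite
    sums converge with the point masses. *)
Lemma lt_integral_near (mu_ : nat -> probability nat R) mu g (c : R) :
  (forall k, (fun n => pmf (mu_ n) k) @ \oo --> pmf mu k) ->
  (forall k, 0 <= g k) -> (c%:E < \int[mu]_k (g k)%:E)%E ->
  \forall n \near \oo, (c%:E < \int[mu_ n]_k (g k)%:E)%E.
Proof.
move=> cvgmu g0; rewrite ge0_integral_nat// => /= cI.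
have gp0 (m : probability nat R) k : (0 <= (g k * pmf m k)%:E)%E.
  by rewrite lee_fin mulr_ge0// pmf_ge0.
have [K cK] : exists K, c < \sum_(0 <= k < K) g k * pmf mu k.
  apply: contrapT => /forallNP nK; move: cI; apply/negP; rewrite -leNgt.
  apply: lime_le; first exact: is_cvg_nneseries.
  by near=> K; rewrite sumEFin lee_fin leNgt; apply/negP; exact: nK.
have : (fun n => \sum_(0 <= k < K) g k * pmf (mu_ n) k) @ \oo -->
    \sum_(0 <= k < K) g k * pmf mu k.
  by apply: cvg_big => [|k _]; [exact: add_continuous|apply: cvgMl_tmp; exact: cvgmu].
move=> /cvgr_gt /(_ _ cK); apply: filterS => n cn.
rewrite ge0_integral_nat// (@lt_le_trans _ _ (\sum_(0 <= k < K) (g k * pmf (mu_ n) k)%:E)%E)//.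
  by rewrite sumEFin lte_fin.
exact: nneseries_lim_ge.
Unshelve. all: by end_near. Qed.

Lemma bounded_integrable_nat mu g (M : R) : (forall k, `|g k| <= M) ->
  mu.-integrable setT (EFin \o g).
Proof.
move=> gM; apply: measurable_bounded_integrable => //.
  by rewrite -ge0_fin_numE// fin_num_measure.
exists M; split; rewrite ?num_real// => x Mx k _ /=.
by rewrite (le_trans (gM k))// ltW.
Qed.

(** Lower semicontinuity applies to both [M + g] and [M - g], which are nonnegative. Since all laws
    have mass 1, the constant [M] cancels and the two one-sided bounds give convergence. *)
Lemma pmf_cvg_integral (mu_ : nat -> probability nat R) mu g (M : R) :
  (forall k, (fun n => pmf (mu_ n) k) @ \oo --> pmf mu k) ->
  (forall k, `|g k| <= M) ->
  (\int[mu_ n]_k (g k)%:E)%E @[n --> \oo] --> (\int[mu]_k (g k)%:E)%E.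
Proof.
move=> cvgmu gM.
have fin (m : probability nat R) : (\int[m]_k (g k)%:E)%E \is a fin_num.
  by apply: integrable_fin_num => //; exact: (bounded_integrable_nat m gM).
have IMg (m : probability nat R) (b : bool) :
    (\int[m]_k (M + (-1) ^+ b * g k)%:E =
     (M + (-1) ^+ b * fine (\int[m]_k (g k)%:E))%:E)%E.
  rewrite (@integralD _ _ _ m _ measurableT (cst M%:E) (fun k => ((-1) ^+ b)%:E * (g k)%:E)%E).
  - rewrite integral_cst//= (@probability_setT _ _ _ m) mule1 integralZl//.
      by rewrite EFinD EFinM fineK.
    exact: (bounded_integrable_nat m gM).
  - exact: finite_measure_integrable_cst.
  - by apply: integrableZl => //; exact: (bounded_integrable_nat m gM).
rewrite -(fineK (fin mu)); apply: cvg_EFin; first by near=> n.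
apply/cvgrPdist_lt => e e0.
have near_b (b : bool) : \forall n \near \oo,
    (-1) ^+ b * fine (\int[mu]_k (g k)%:E) - e <
    (-1) ^+ b * fine (\int[mu_ n]_k (g k)%:E).
  have := @lt_integral_near mu_ mu (fun k => M + (-1) ^+ b * g k)
    (M + (-1) ^+ b * fine (\int[mu]_k (g k)%:E) - e) cvgmu.
  have g0 k : 0 <= M + (-1) ^+ b * g k.
    by have := gM k; rewrite ler_norml; case: b => /andP[]; lra.
  move=> /(_ g0); rewrite IMg lte_fin => H.
  have {}H := H ltac:(by lra).
  by apply: filterS H => n; rewrite IMg lte_fin; lra.
have := near_b true; have := near_b false; apply: filterS2 => n /=.
by rewrite ltr_norml expr0 expr1 !mul1r; lra.
Unshelve. all: by end_near. Qed.

End nat_law.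

(** * From generating functions to point masses *)

Section generating_function.
Context {R : realType}.
Implicit Types (mu : probability nat R) (s : R).

Definition gf mu s : R := fine (\int[mu]_k (s ^+ k)%:E).

(** The generating series with its first [k] terms removed, divided by [s ^+ k]; its constant term
    is the mass at [k]. *)
Definition tail_gf mu k s : R :=
  fine (\int[mu]_(j in [set j | (k <= j)%N]) (s ^+ (j - k))%:E).

Lemma le1_integral_nat mu (D : set nat) (g : nat -> R) :
  (forall k, 0 <= g k <= 1) ->
  (0 <= \int[mu]_(k in D) (g k)%:E <= 1)%E.
Proof.
move=> g01; apply/andP; split.
  by apply: integral_ge0 => k _; rewrite lee_fin; have /andP[] := g01 k.
apply: (@le_trans _ _ (\int[mu]_(k in D) cst 1 k)%E); last first.
  by rewrite integral_cst// mul1e probability_le1.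
by apply: ge0_le_integral => //= k _; rewrite lee_fin; have /andP[] := g01 k.
Qed.

Lemma le1_integral_nat_fin mu (D : set nat) (g : nat -> R) :
  (forall k, 0 <= g k <= 1) -> (\int[mu]_(k in D) (g k)%:E)%E \is a fin_num.
Proof.
move=> g01; have /andP[I0 I1] := le1_integral_nat mu D g01.
by rewrite ge0_fin_numE// (le_lt_trans I1)// ltry.
Qed.

Lemma expr01 s k : 0 <= s <= 1 -> 0 <= s ^+ k <= 1.
Proof. by move=> /andP[s0 s1]; rewrite exprn_ge0// exprn_ile1. Qed.

Lemma tail_gf01 mu k s : 0 <= s <= 1 -> 0 <= tail_gf mu k s <= 1.
Proof.
move=> s01; have e01 j : 0 <= s ^+ (j - k) <= 1 by exact: expr01.
by rewrite -!lee_fin fineK ?le1_integral_nat_fin// le1_integral_nat.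
Qed.

Lemma tail_gf_rec mu k s : 0 <= s <= 1 ->
  tail_gf mu k s = pmf mu k + s * tail_gf mu k.+1 s.
Proof.
move=> s01; have e01 i j : 0 <= s ^+ (j - i) <= 1 by exact: expr01.
have s0 : 0 <= s by case/andP: s01.
apply: EFin_inj; rewrite EFinD EFinM !fineK ?le1_integral_nat_fin ?fin_num_measure//.
have -> : [set j | (k <= j)%N] = [set k] `|` [set j | (k.+1 <= j)%N].
  apply/seteqP; split=> [j /=|j /= [->//|/ltnW//]].
  by rewrite leq_eqVlt => /orP[/eqP->|]; [left|right].
rewrite ge0_integral_setU//=; first last.
- apply/disj_setPS => j [/= ->]; by rewrite ltnn.
- by move=> j _; rewrite lee_fin; have /andP[] := e01 k j.
congr (_ + _)%E; first by rewrite integral_nat_set1 subnn mul1r pmfE.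
rewrite -ge0_integralZl_EFin//.
- apply: eq_integral => j; rewrite inE /= => kj.
  by rewrite -EFinM -exprS -subSn ?subSS.
- by move=> j _; rewrite lee_fin; have /andP[] := e01 k.+1 j.
Qed.

Lemma tail_gf0 mu s : tail_gf mu 0 s = gf mu s.
Proof.
rewrite /tail_gf /gf; congr fine.
have -> : [set j | (0 <= j)%N] = setT by apply/seteqP; split.
by apply: eq_integral => j _; rewrite subn0.
Qed.

Lemma pmf_tail_gf mu k s : 0 <= s <= 1 ->
  pmf mu k <= tail_gf mu k s <= pmf mu k + s.
Proof.
move=> s01; have /andP[t0 t1] := tail_gf01 mu k.+1 s01.
have /andP[s0 s1] := s01.
rewrite tail_gf_rec// lerDl mulr_ge0//= lerD2l.
by rewrite -[leRHS]mulr1 ler_wpM2l.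
Qed.

Lemma gf0 mu : gf mu 0 = pmf mu 0.
Proof. by rewrite -tail_gf0 tail_gf_rec ?lexx ?ler01// mul0r addr0. Qed.

(* [tail_gf mu k s] lies between [pmf mu k] and [pmf mu k + s], so letting
   [s] tend to 0 the masses converge one after the other. *)
Lemma gf_cvg_pmf (mu_ : nat -> probability nat R) mu :
  (forall s, 0 < s < 1 -> (fun n => gf (mu_ n) s) @ \oo --> gf mu s) ->
  forall k, (fun n => pmf (mu_ n) k) @ \oo --> pmf mu k.
Proof.
move=> cvggf.
have pmf_of_tail k :
    (forall s, 0 < s < 1 -> (fun n => tail_gf (mu_ n) k s) @ \oo --> tail_gf mu k s) ->
    (fun n => pmf (mu_ n) k) @ \oo --> pmf mu k.
  move=> tk; apply/cvgrPdist_lt => e e0.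
  (* Replacing the masses by tails costs at most [s <= e / 2], and the convergence of the tails
     costs the other [e / 2]; the bound 1/2 keeps [s] below 1. *)
  pose s := Num.min (e / 2) (1 / 2).
  have s01 : 0 < s < 1 by rewrite lt_min gt_min; apply/andP; split; lra.
  have se : s <= e / 2 by rewrite ge_min lexx.
  have e20 : 0 < e / 2 by lra.
  have /cvgrPdist_lt /(_ _ e20) := tk s s01; apply: filterS => n.
  have s01' : 0 <= s <= 1 by case/andP: s01 => /ltW-> /ltW.
  have /andP[] := pmf_tail_gf mu k s01'.
  have /andP[] := pmf_tail_gf (mu_ n) k s01'.
  by rewrite !ltr_norml; lra.
suff tk k s : 0 < s < 1 ->
    (fun n => tail_gf (mu_ n) k s) @ \oo --> tail_gf mu k s.
  by move=> k; apply: pmf_of_tail => s; exact: tk.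
elim: k s => [|k IH] s s01.
  by rewrite tail_gf0; under eq_fun do rewrite tail_gf0; exact: cvggf.
have s0 : s != 0 by rewrite gt_eqF//; case/andP: s01.
have s01' : 0 <= s <= 1 by case/andP: s01 => /ltW-> /ltW.
have recE m : tail_gf m k.+1 s = (tail_gf m k s - pmf m k) / s.
  by rewrite (tail_gf_rec m k s01') addrAC subrr add0r mulrC mulKf.
rewrite recE; under eq_fun do rewrite recE.
apply: cvgMr_tmp; apply: cvgB; first exact: IH.
exact: pmf_of_tail.
Qed.

End generating_function.

(** * The generating function of the branching process *)

Section independent_event.
Context d d' (T : measurableType d) (T' : measurableType d') (R : realType).
Context (P : probability T R) (I : choiceType).
Variable X : I -> {RV P >-> T'}.
Implicit Types (F : set I) (E : set T).

(** Independence of [E] from the family indexed by [F], with the product over the family already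
    expanded: the property then passes to [E] intersected with one more condition on some [X i], at
    the cost of removing [i] from [F]. *)
Definition event_indep F E : Prop :=
  forall s : seq I, uniq s -> [set` s] `<=` F ->
  forall A : I -> set T', (forall i, measurable (A i)) ->
  P (E `&` \bigcap_(i in [set` s]) (X i @^-1` A i)) =
  (P E * \prod_(i <- s) P (X i @^-1` A i))%E.

Lemma measurable_preimages (s : seq I) (A : I -> set T') :
  (forall i, measurable (A i)) ->
  measurable (\bigcap_(i in [set` s]) (X i @^-1` A i)).
Proof.
move=> mA; rewrite bigcap_seq; apply: bigsetI_measurable => i _.
exact: measurable_funPTI.
Qed.

Lemma sub_event_indep F F' E : F' `<=` F -> event_indep F E -> event_indep F' E.
Proof. by move=> FF' FE s us sF'; apply: FE => // i /sF'; exact: FF'. Qed.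

Lemma event_indep_setT F : mutually_independent P F X -> event_indep F setT.
Proof.
move=> indX s us sF A mA.
by rewrite setTI probability_setT mul1e; exact: indX.
Qed.

Lemma event_indep_set0 F : event_indep F set0.
Proof. by move=> s us sF A mA; rewrite set0I measure0 mul0e. Qed.

Lemma event_indep_bigcup F (E : nat -> set T) : (forall k, measurable (E k)) ->
  trivIset setT E -> (forall k, event_indep F (E k)) ->
  event_indep F (\bigcup_k E k).
Proof.
move=> mE tE indE s us sF A mA.
have mA' := measurable_preimages s mA.
have pfin : (\prod_(i <- s) P (X i @^-1` A i))%E \is a fin_num.
  elim: (s) => [|i s' IH]; first by rewrite big_nil.
  by rewrite big_cons fin_numM// fin_num_measure//; exact: measurable_funPTI.
have p0 : (0 <= \prod_(i <- s) P (X i @^-1` A i))%E.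
  by apply: prode_ge0 => i _.
rewrite setI_bigcupl !measure_semi_bigcup//; first last.
- by apply: bigcup_measurable => k _; exact: measurableI.
- by move=> i j _ _ [w [[Eiw _] [Ejw _]]]; apply: tE => //; exists w.
- by move=> k; exact: measurableI.
- by apply: bigcup_measurable => k _; exact: mE.
- rewrite muleC -(fineK pfin) -nneseriesZl//.
  by apply: eq_eseriesr => k _; rewrite fineK// muleC; exact: indE.
Qed.

Lemma event_indepI1 F E i (C : set T') : F i -> measurable C ->
  event_indep F E -> P (E `&` X i @^-1` C) = (P E * P (X i @^-1` C))%E.
Proof.
move=> Fi mC /(_ [:: i] isT) /(_ _ (fun=> C) (fun=> mC)).
rewrite set_cons1 bigcap_set1 big_seq1; apply.
by move=> _ ->.
Qed.

Lemma event_indepI F E i (C : set T') : F i -> measurable C ->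
  event_indep F E -> event_indep (F `\ i) (E `&` X i @^-1` C).
Proof.
move=> Fi mC indE s us sF A mA.
rewrite (event_indepI1 Fi mC indE).
have iNs : i \notin s by apply/negP => /sF [_]; apply.
(* The condition [C] is attached to the fresh index [i], so that the hypothesis can be used for
   [i :: s]. *)
pose A' j := if j == i then C else A j.
have sA' j : j \in s -> A' j = A j.
  by rewrite /A'; case: eqP => // -> is_; rewrite is_ in iNs.
have := indE (i :: s) _ _ A'.
rewrite /= iNs us big_cons /A' eqxx -/A' => /(_ isT) H.
have {H} := H _ _; rewrite muleA.
have -> : \bigcap_(j in [set` i :: s]) (X j @^-1` A' j) =
    X i @^-1` C `&` \bigcap_(j in [set` s]) (X j @^-1` A j).
  apply/seteqP; split=> [w H|w [Cw H] j /=].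
    split; first by have := H i; rewrite /A' /= eqxx; apply; rewrite inE eqxx.
    move=> j js; have := H j; rewrite sA'//; apply.
    by rewrite /= inE; apply/orP; right.
  by rewrite inE => /orP[/eqP ->|js]; [rewrite /A' eqxx|rewrite sA'//; exact: H].
have -> : (\prod_(j <- s) P (X j @^-1` A' j) = \prod_(j <- s) P (X j @^-1` A j))%E.
  by apply: eq_big_seq => j js; rewrite sA'.
rewrite setIA; apply.
  by move=> j /=; rewrite inE => /orP[/eqP ->//|/sF[]].
by move=> j; rewrite /A'; case: ifP.
Qed.

End independent_event.

(** On each piece of [D] where [X] is constant, [Y] has conditional law [mu]. Splitting along [X]
    and then along [Y] reduces the claim to this. *)
Lemma ge0_integral_nat_indep d (T : measurableType d) (R : realType)
    (P : probability T R) (D : set T) (X Y : T -> nat)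
    (mu : probability nat R) (f g : nat -> R) :
  measurable D -> measurable_fun [set: T] X -> measurable_fun [set: T] Y ->
  (forall k, 0 <= f k) -> (forall k, 0 <= g k) ->
  (\int[mu]_j (g j)%:E)%E \is a fin_num ->
  (forall k j, P (D `&` [set w | X w = k] `&` [set w | Y w = j]) =
     P (D `&` [set w | X w = k]) * mu [set j])%E ->
  (\int[P]_(w in D) (f (X w) * g (Y w))%:E =
   \int[P]_(w in D) (f (X w))%:E * \int[mu]_j (g j)%:E)%E.
Proof.
move=> mD mX mY f0 g0 gfin indXY.
have mDX k : measurable (D `&` [set w | X w = k]).
  by apply: measurableI => //; exact: measurable_nat_eq.
have mf := measurable_fun_nat_comp f mX.
have mg := measurable_fun_nat_comp g mY.
under eq_integral do rewrite EFinM.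
rewrite (ge0_integral_setI_level _ mD mX)//; last 2 first.
- exact: emeasurable_funM.
- by move=> w; rewrite mule_ge0// lee_fin.
rewrite (ge0_integral_setI_level _ mD mX mf)//; last by move=> w; rewrite lee_fin.
rewrite muleC -(fineK gfin) -nneseriesZl//; last first.
  by move=> k _; apply: integral_ge0 => w _; rewrite lee_fin.
apply: eq_eseriesr => k _.
transitivity (\int[P]_(w in D `&` [set w | X w = k]) ((f k)%:E * (g (Y w))%:E))%E.
  by apply: eq_integral => w; rewrite inE => -[_ /= ->].
rewrite ge0_integralZl_EFin//; last 2 first.
- by move=> w _; rewrite lee_fin.
- exact: measurable_funS mg.
rewrite fineK// integral_setI_level// muleCA; congr (_ * _)%E; rewrite muleC.
rewrite (ge0_integral_setI_level _ (mDX k) mY mg)//; last by move=> w; rewrite lee_fin.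
rewrite ge0_integral_nat//.
have [p Pp] : exists p, P (D `&` [set w | X w = k]) = p%:E.
  by exists (fine (P (D `&` [set w | X w = k]))); rewrite fineK// fin_num_measure.
rewrite [Z in (Z * _)%E](Pp : _ = _) -nneseriesZl; last first.
  by move=> j _; rewrite lee_fin mulr_ge0// pmf_ge0.
apply: eq_eseriesr => j _.
rewrite integral_setI_level// EFinM pmfE muleCA; congr (_ * _)%E.
by rewrite -Pp; exact: indXY.
Qed.

(** * Recursion for the generating function of a generation *)

Section branching.
Context d (T : measurableType d) (R : realType) (P : probability T R).
Variables (xi0 : nat -> {RV P >-> nat}) (xi : nat -> nat -> {RV P >-> nat}).
Hypothesis xi_indep : mutually_independent P
  [set ij : nat * nat | (0 < ij.1)%N /\ (0 < ij.2)%N]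
  (fun ij => xi ij.1 ij.2).
Hypothesis xi_ident : forall n j : nat, (0 < n)%N -> (0 < j)%N ->
  distribution P (xi n j) = distribution P (xi0 n).

(** Generation [n.+1] is [brood n.+1 r] on the event [gw xi n = r]; a fixed [r] avoids a random
    number of summands. *)
Definition brood n r w : nat := (\sum_(1 <= j < r.+1) xi n j w)%N.

Lemma brood0 n w : brood n 0 w = 0%N.
Proof. by rewrite /brood big_geq. Qed.

Lemma broodS n r w : brood n r.+1 w = (brood n r w + xi n r.+1 w)%N.
Proof. by rewrite /brood big_nat_recr. Qed.

Lemma measurable_brood n r : measurable_fun [set: T] (brood n r).
Proof.
elim: r => [|r IH].
  have -> : brood n 0 = cst 0%N by apply/funext => w; exact: brood0.
  exact: measurable_cst.
have -> : brood n r.+1 = (fun w => brood n r w + xi n r.+1 w)%N.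
  by apply/funext => w; exact: broodS.
by apply: measurable_fun_natD => //; exact: measurable_funPT.
Qed.

Let measurable_gw_eq n l : measurable [set w | gw xi n w = l].
Proof. by apply: measurable_nat_eq; exact: measurable_gw. Qed.

Let measurable_state n l r m :
  measurable ([set w | gw xi n w = l] `&` [set w | brood n.+1 r w = m]).
Proof.
by apply: measurableI => //; apply: measurable_nat_eq; exact: measurable_brood.
Qed.

(** The indices not yet consulted once generation [n] and the first [r] families of generation
    [n.+1] are known. *)
Definition unborn n r : set (nat * nat) :=
  [set ij | (n.+1 < ij.1)%N /\ (0 < ij.2)%N \/ ij.1 = n.+1 /\ (r < ij.2)%N].

(** Induction on [n], then on [r]. Raising [r] splits the event by the previous partial sum and
    consumes one fresh variable, which leaves the set of unborn indices. *)
Lemma brood_event_indep n l r m :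
  event_indep (fun ij => xi ij.1 ij.2) (unborn n r)
    ([set w | gw xi n w = l] `&` [set w | brood n.+1 r w = m]).
Proof.
have indepS n' r' : (forall l m, event_indep (fun ij => xi ij.1 ij.2) (unborn n' r')
      ([set w | gw xi n' w = l] `&` [set w | brood n'.+1 r' w = m])) ->
    forall l m, event_indep (fun ij => xi ij.1 ij.2) (unborn n' r'.+1)
      ([set w | gw xi n' w = l] `&` [set w | brood n'.+1 r'.+1 w = m]).
  move=> IH l' m'.
  have -> : [set w | gw xi n' w = l'] `&` [set w | brood n'.+1 r'.+1 w = m'] =
      \bigcup_k ([set w | gw xi n' w = l'] `&` [set w | brood n'.+1 r' w = k] `&`
        xi n'.+1 r'.+1 @^-1` [set j | (k + j)%N = m']).
    apply/seteqP; split => [w [/= <-]|w [k _ [[/= <- <-] /= <-]]].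
      by rewrite broodS => <-; exists (brood n'.+1 r' w).
    by split=> //; rewrite broodS.
  apply: event_indep_bigcup => [k||k].
  - by apply: measurableI => //; exact: measurable_funPTI.
  - by move=> i j _ _ [w [[[_ /= <-] _] [[_ /= <-] _]]].
  - have i_unborn : unborn n' r' (n'.+1, r'.+1) by right; split=> /=.
    apply: sub_event_indep (event_indepI i_unborn _ (IH l' k)) => //.
    move=> [i j] /= [[/= ni j0]|[/= -> rj]].
      by split; [left|case=> ni'; rewrite ni' ltnn in ni].
    by split; [right; split=> //; exact: ltnW|case=> jr; rewrite jr ltnn in rj].
elim: n l r m => [|n IHn] l r m.
  elim: r l m => [|r IHr] l m; last exact: indepS.
  have -> : [set w | gw xi 0 w = l] `&` [set w | brood 1 0 w = m] =
      if (l == 1%N) && (m == 0%N) then setT else set0.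
    apply/seteqP; split => w /=.
      by rewrite brood0 => -[<- <-]; rewrite !eqxx.
    by case: ifP => // /andP[/eqP -> /eqP ->] _; rewrite brood0.
  case: ifP => _; last exact: event_indep_set0.
  apply: sub_event_indep (event_indep_setT xi_indep) => -[i j].
  by case=> -[/= i1 j0]; split=> //=; rewrite ?(ltn_trans _ i1) ?i1.
elim: r l m => [|r IHr] l m; last exact: indepS.
(* With no family of generation [n.+2] counted, the event concerns generation [n.+1] only; splitting
   it by the size [k] of generation [n] leads to the induction hypothesis with [r = k]. It is empty
   unless [m = 0]. *)
have -> : [set w | gw xi n.+1 w = l] `&` [set w | brood n.+2 0 w = m] =
    \bigcup_k (if m == 0%N then [set w | gw xi n w = k] `&`
      [set w | brood n.+1 k w = l] else set0).
  apply/seteqP; split => w /=.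
    by rewrite brood0 => -[gl <-]; exists (gw xi n w).
  by case=> k _; case: ifP => // /eqP -> [/= gk bl]; rewrite brood0 gk.
apply: event_indep_bigcup => [k||k].
- by case: ifP.
- by move=> i j _ _ [w]; case: ifP => _ [] // [/= <- _] [/= <- _].
- case: ifP => _; last exact: event_indep_set0.
  apply: sub_event_indep (IHn k k l) => -[i j].
  by case=> -[/= i1 j0]; left; split=> //=; rewrite ?(ltn_trans _ i1) ?i1.
Qed.

Definition offspring n : probability nat R := distribution P (xi0 n).

Lemma gf_distribution (X : {RV P >-> nat}) (s : R) : 0 <= s <= 1 ->
  (\int[P]_w (s ^+ X w)%:E)%E = (gf (distribution P X) s)%:E.
Proof.
move=> s01; have e01 k : 0 <= s ^+ k <= 1 by exact: expr01.
rewrite /gf fineK ?le1_integral_nat_fin//.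
by rewrite ge0_integral_distribution// => k; rewrite lee_fin; case/andP: (e01 k).
Qed.

(** Each further family is independent of the size of generation [n] and of the families before it,
    so it contributes one more factor. *)
Lemma integral_brood n l r (u : R) : 0 <= u <= 1 ->
  (\int[P]_(w in [set w | gw xi n w = l]) (u ^+ brood n.+1 r w)%:E =
   P [set w | gw xi n w = l] * (gf (offspring n.+1) u ^+ r)%:E)%E.
Proof.
move=> u01; have e01 k : 0 <= u ^+ k <= 1 by exact: expr01.
have e0 k : 0 <= u ^+ k by case/andP: (e01 k).
elim: r => [|r IH].
  rewrite mule1 -[RHS]mul1e -integral_cst//.
  by apply: eq_integral => w _; rewrite brood0.
under eq_integral do rewrite broodS exprD.
rewrite (@ge0_integral_nat_indep _ _ _ _ _ (brood n.+1 r) (xi n.+1 r.+1)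
  (offspring n.+1) (fun k => u ^+ k) (fun k => u ^+ k))//.
- rewrite IH -muleA; congr (_ * _)%E.
  by rewrite exprSr EFinM /gf fineK ?le1_integral_nat_fin.
- exact: measurable_brood.
- exact: le1_integral_nat_fin.
- move=> k j.
  have i_unborn : unborn n r (n.+1, r.+1) by right; split=> /=.
  have := event_indepI1 i_unborn _ (@brood_event_indep n l r k).
  move=> /(_ [set j]) /= /(_ I) H.
  by rewrite /offspring -(@xi_ident n.+1 r.+1).

Qed.

Lemma gf_gwS n (u : R) : 0 <= u <= 1 ->
  gf (distribution P (gw xi n.+1)) u =
  gf (distribution P (gw xi n)) (gf (offspring n.+1) u).
Proof.
move=> u01; have e01 k : 0 <= u ^+ k <= 1 by exact: expr01.
have f01 : 0 <= gf (offspring n.+1) u <= 1.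
  by rewrite -!lee_fin /gf fineK ?le1_integral_nat_fin ?le1_integral_nat.
have fe01 k : 0 <= gf (offspring n.+1) u ^+ k <= 1 by exact: expr01.
apply: EFin_inj; rewrite -!gf_distribution//.
have mX : measurable_fun [set: T] (gw xi n) by exact: measurable_gw.
have mX1 : measurable_fun [set: T] (gw xi n.+1) by exact: measurable_gw.
rewrite (ge0_integral_setI_level _ measurableT mX); last 2 first.
- exact: measurable_fun_nat_comp.
- by move=> w; rewrite lee_fin; case/andP: (e01 (gw xi n.+1 w)).
rewrite [RHS](ge0_integral_setI_level _ measurableT mX); last 2 first.
- exact: measurable_fun_nat_comp.
- by move=> w; rewrite lee_fin; case/andP: (fe01 (gw xi n w)).
apply: eq_eseriesr => l _.
rewrite integral_setI_level// setTI muleC -integral_brood//.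
by apply: eq_integral => w; rewrite inE /= => <-.
Qed.

End branching.

(** * Moments and generating functions *)

Section power_bounds.
Context {R : realType}.
Implicit Types (x : R) (k : nat).

(** Pascal's rule multiplied by [(m + 1)!]. *)
Lemma ffactS_split m k : (k.+1 ^_ m.+1 = k ^_ m.+1 + m.+1 * k ^_ m)%N.
Proof.
rewrite ffactSS ffactnSr; have [mk|km] := leqP m k.
  by rewrite mulnC [(m.+1 * _)%N]mulnC -mulnDr addnS subnK.
by rewrite ffact_small// !muln0.
Qed.

Lemma ffact2S k : ((k.+1 ^_ 2)%:R : R) = (k ^_ 2)%:R + 2 * k%:R.
Proof. by rewrite ffactS_split ffactn1 natrD natrM. Qed.

Lemma ffact3S k : ((k.+1 ^_ 3)%:R : R) = (k ^_ 3)%:R + 3 * (k ^_ 2)%:R.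
Proof. by rewrite ffactS_split natrD natrM. Qed.

Lemma onem_exp01 x k : 0 <= x <= 1 -> 0 <= 1 - (1 - x) ^+ k <= 1.
Proof.
move=> x01; have /andP[] : 0 <= (1 - x) ^+ k <= 1 by apply: expr01; lra.
lra.
Qed.

Lemma onem_expS x k :
  1 - (1 - x) ^+ k.+1 = (1 - (1 - x) ^+ k) * (1 - x) + x.
Proof. by rewrite exprS; ring. Qed.

Lemma onem_exp_le x k : 0 <= x <= 1 -> 1 - (1 - x) ^+ k <= k%:R * x.
Proof.
move=> x01; elim: k => [|k IH]; first by rewrite expr0 subrr mul0r.
have /andP[h0 _] := onem_exp01 k x01.
have hx : 0 <= (1 - (1 - x) ^+ k) * x by rewrite mulr_ge0//; case/andP: x01.
by rewrite onem_expS -natr1; lra.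
Qed.

(** With the bounds before and after it, one of the first three Bonferroni inequalities for [k]
    independent events of probability [x]. Terms change sides so as to carry plus signs, which lets
    both sides be integrated as nonnegative functions. The induction multiplies by [1 - x] and drops
    a term of known sign. *)
Lemma onem_exp_ge x k : 0 <= x <= 1 ->
  k%:R * x <= 1 - (1 - x) ^+ k + (k ^_ 2)%:R / 2 * x ^+ 2.
Proof.
move=> x01; elim: k => [|k IH]; first by rewrite expr0 subrr !mul0r addr0.
rewrite onem_expS ffact2S -natr1.
have x10 : 0 <= 1 - x by lra.
have := ler_wpM2r x10 IH.
have : 0 <= (k ^_ 2)%:R / 2 * x ^+ 3.
  by rewrite mulr_ge0 ?exprn_ge0 ?divr_ge0 ?ler0n//; case/andP: x01.
lra.
Qed.

Lemma onem_exp_le3 x k : 0 <= x <= 1 ->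
  1 - (1 - x) ^+ k + (k ^_ 2)%:R / 2 * x ^+ 2 <=
  k%:R * x + (k ^_ 3)%:R / 6 * x ^+ 3.
Proof.
move=> x01; elim: k => [|k IH]; first by rewrite expr0 subrr !mul0r addr0.
rewrite onem_expS ffact2S ffact3S -[k.+1%:R]natr1.
have x10 : 0 <= 1 - x by lra.
have := ler_wpM2r x10 IH.
have : 0 <= (k ^_ 3)%:R / 6 * x ^+ 4.
  by rewrite mulr_ge0 ?exprn_ge0 ?divr_ge0 ?ler0n//; case/andP: x01.
lra.
Qed.

End power_bounds.

(** * Bounds and slope at 0 of the complementary generating function *)

Section extinction_defect.
Context {R : realType}.
Implicit Types (mu : probability nat R) (x a b c : R).

Definition gf_defect mu x : R := 1 - gf mu (1 - x).

Lemma gf_defectE mu x : 0 <= x <= 1 ->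
  (\int[mu]_k (1 - (1 - x) ^+ k)%:E = (gf_defect mu x)%:E)%E.
Proof.
move=> x01; have z01 : 0 <= 1 - x <= 1 by lra.
have e01 k : 0 <= (1 - x) ^+ k <= 1 by exact: expr01.
have d01 k : 0 <= 1 - (1 - x) ^+ k <= 1 by exact: onem_exp01.
have fin := le1_integral_nat_fin mu setT e01.
rewrite /gf_defect /gf EFinB fineK// -[LHS](addeK _ fin) -ge0_integralD//.
- congr (_ - _)%E; rewrite (eq_integral (cst 1%E)); last first.
    by move=> k _; rewrite -EFinD subrK.
  by rewrite integral_cst//= mul1e (@probability_setT _ _ _ mu).
- by move=> k _; rewrite lee_fin; case/andP: (d01 k).
- by move=> k _; rewrite lee_fin; case/andP: (e01 k).
Qed.

Lemma gf_defect_le mu x a : 0 <= x <= 1 ->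
  (\int[mu]_k (k%:R : R)%:E = a%:E)%E -> gf_defect mu x <= a * x.
Proof.
move=> x01 mua; rewrite -lee_fin -gf_defectE// mulrC EFinM -mua.
have x0 : 0 <= x by case/andP: x01.
rewrite -ge0_integralZl_EFin//.
apply: ge0_le_integral => //=.
- by move=> k _; rewrite lee_fin; case/andP: (onem_exp01 k x01).
- by move=> k _; rewrite -EFinM lee_fin mulrC; exact: onem_exp_le.
Qed.

Lemma gf_defect_ge mu x a b : 0 <= x <= 1 ->
  (\int[mu]_k (k%:R : R)%:E = a%:E)%E ->
  (\int[mu]_k ((k ^_ 2)%:R : R)%:E = b%:E)%E ->
  a * x <= gf_defect mu x + b / 2 * x ^+ 2.
Proof.
move=> x01 mua mub; have x0 : 0 <= x by case/andP: x01.
have xx0 : 0 <= x ^+ 2 / 2 by rewrite divr_ge0 ?sqr_ge0.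
have d0 k : 0 <= 1 - (1 - x) ^+ k by case/andP: (onem_exp01 k x01).
rewrite -lee_fin EFinD -gf_defectE// [a * x]mulrC EFinM -mua.
rewrite -mulrA [b * _]mulrC [_ * x ^+ 2]mulrC EFinM -mub.
rewrite -!ge0_integralZl_EFin//; try by move=> k _; rewrite lee_fin.
rewrite -ge0_integralD//; last 2 first.
- by move=> k _; rewrite lee_fin.
- by move=> k _; rewrite mule_ge0// lee_fin.
apply: ge0_le_integral => //=.
- by move=> k _; rewrite mule_ge0// lee_fin.
- move=> k _; rewrite -!EFinM -EFinD lee_fin mulrC.
  by apply: le_trans (onem_exp_ge k x01) _; lra.
Qed.

Lemma gf_defect_le3 mu x a b c : 0 <= x <= 1 ->
  (\int[mu]_k (k%:R : R)%:E = a%:E)%E ->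
  (\int[mu]_k ((k ^_ 2)%:R : R)%:E = b%:E)%E ->
  (\int[mu]_k ((k ^_ 3)%:R : R)%:E = c%:E)%E ->
  gf_defect mu x + b / 2 * x ^+ 2 <= a * x + c / 6 * x ^+ 3.
Proof.
move=> x01 mua mub muc; have x0 : 0 <= x by case/andP: x01.
have xx0 : 0 <= x ^+ 2 / 2 by rewrite divr_ge0 ?sqr_ge0.
have xxx0 : 0 <= x ^+ 3 / 6 by rewrite divr_ge0 ?exprn_ge0.
have d0 k : 0 <= 1 - (1 - x) ^+ k by case/andP: (onem_exp01 k x01).
rewrite -lee_fin [in leLHS]EFinD [in leRHS]EFinD -gf_defectE//.
rewrite [a * x]mulrC (EFinM x a) -mua.
rewrite -!mulrA [b * _]mulrC [_ * x ^+ 2]mulrC (EFinM (x ^+ 2 / 2) b) -mub.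
rewrite [c * _]mulrC [_ * x ^+ 3]mulrC (EFinM (x ^+ 3 / 6) c) -muc.
rewrite -!ge0_integralZl_EFin//; try by move=> k _; rewrite lee_fin.
rewrite -!ge0_integralD//;
  try by move=> k _; rewrite ?mule_ge0 ?lee_fin.
apply: ge0_le_integral => //=.
- by move=> k _; rewrite -!EFinM -EFinD lee_fin addr_ge0 ?mulr_ge0.
- move=> k _; rewrite -!EFinM -!EFinD lee_fin.
  by have := onem_exp_le3 k x01; lra.
Qed.

(** A positive mean forces positive mass at some [k > 0], where the integrand [1 - (1 - x) ^+ k] is
    positive. *)
Lemma gf_defect01 mu x a : 0 < x <= 1 -> 0 < a ->
  (\int[mu]_k (k%:R : R)%:E = a%:E)%E -> 0 < gf_defect mu x <= 1.
Proof.
move=> /andP[x0 x1] a0 mua.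
have x01 : 0 <= x <= 1 by rewrite ltW.
have d01 k := onem_exp01 k x01.
have dE := gf_defectE mu x01.
apply/andP; split; last first.
  by rewrite -lee_fin -dE; case/andP: (le1_integral_nat mu setT d01).
have [k muk] : exists k, k%:R * pmf mu k != 0.
  apply: contrapT => /forallNP mu0; move: mua.
  rewrite ge0_integral_nat// eseries0.
    by case=> a00; rewrite -a00 ltxx in a0.
  by move=> k _ _; move/negP: (mu0 k); rewrite negbK => /eqP ->.
rewrite -lte_fin -dE.
apply: (@lt_le_trans _ _ (\int[mu]_(j in [set k]) (1 - (1 - x) ^+ j)%:E)%E); last first.
  apply: ge0_subset_integral => // j _.
  by rewrite lee_fin; case/andP: (d01 j).
move: muk; rewrite mulf_eq0 negb_or => /andP[k0 muk0].
rewrite (integral_nat_set1 mu (fun j => 1 - (1 - x) ^+ j)) lte_fin mulr_gt0//; last first.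
  by rewrite lt_neqAle eq_sym muk0 pmf_ge0.
rewrite subr_gt0 exprn_ilt1; [by move: k0; rewrite pnatr_eq0|lra|lra].
Qed.

(** Dominated convergence: [(1 - (1 - y) ^+ k) / y] tends to [k] as [y] tends to 0 and never exceeds
    [k], which is integrable because the mean is finite. *)
Lemma gf_defect_deriv0 mu a (y : nat -> R) :
  (\int[mu]_k (k%:R : R)%:E = a%:E)%E ->
  (forall m, 0 < y m <= 1) -> y @ \oo --> (0 : R) ->
  (fun m => gf_defect mu (y m) / y m) @ \oo --> a.
Proof.
move=> mua y01 y0.
have y01' m : 0 <= y m <= 1 by case/andP: (y01 m) => /ltW -> ->.
pose f m k : R := (1 - (1 - y m) ^+ k) / y m.
have fle m k : f m k <= k%:R.
  have /andP[ym _] := y01 m.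
  by rewrite /f ler_pdivrMr//; exact: onem_exp_le.
have f0 m k : 0 <= f m k.
  rewrite /f divr_ge0//; first by case/andP: (onem_exp01 k (y01' m)).
  by case/andP: (y01' m).
have fcvg k : (fun m => f m k) @ \oo --> (k%:R : R).
  apply: (@squeeze_cvgr _ _ _ _ (fun m => k%:R - (k ^_ 2)%:R / 2 * y m) (cst k%:R)).
  - near=> m; rewrite fle andbT.
    have /andP[ym _] := y01 m.
    rewrite /f ler_pdivlMr//; have := onem_exp_ge k (y01' m).
    by lra.
  - rewrite -[X in _ --> X]subr0 -(mulr0 ((k ^_ 2)%:R / 2)).
    by apply: cvgB; [exact: cvg_cst|exact: cvgMl_tmp].
  - exact: cvg_cst.
have intk : mu.-integrable setT (fun k => (k%:R : R)%:E).
  apply/integrableP; split => //.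
  under eq_integral do rewrite gee0_abs ?lee_fin//.
  by rewrite mua ltry.
have [] := @dominated_convergence _ _ _ mu setT measurableT
  (fun m k => (f m k)%:E) (fun k => (k%:R : R)%:E) (fun k => (k%:R : R)%:E).
- by [].
- by [].
- apply: aeW => k _; apply: cvg_EFin; first by near=> m.
  exact: fcvg.
- exact: intk.
- by apply: aeW => k m _; rewrite gee0_abs lee_fin.
rewrite mua => _ _ /fine_cvg; apply: cvg_trans; apply: near_eq_cvg; near=> m.
have ym0 : y m != 0 by rewrite gt_eqF//; case/andP: (y01 m).
rewrite /= -(mulKf ym0 (fine _)) mulrC; congr (_ / _).
apply: EFin_inj; rewrite -gf_defectE// EFinM fineK; last first.
  rewrite ge0_fin_numE; last by apply: integral_ge0 => k _; rewrite lee_fin.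
  apply: (@le_lt_trans _ _ (\int[mu]_k (k%:R)%:E)%E); last by rewrite mua ltry.
  by apply: ge0_le_integral => //= k _; rewrite lee_fin.
rewrite -ge0_integralZl_EFin//; last 2 first.
- by move=> k _; rewrite lee_fin.
- by case/andP: (y01' m).
by apply: eq_integral => k _; rewrite -EFinM mulrC divfK.
Unshelve. all: by end_near. Qed.

End extinction_defect.

(** * Moments and conditioning in terms of laws *)

Section laws.
Context d (T : measurableType d) (R : realType) (P : probability T R).
Implicit Types X : {RV P >-> nat}.

Lemma mean_distribution X :
  mean P X = (\int[distribution P X]_k (k%:R : R)%:E)%E.
Proof.
rewrite ge0_integral_distribution//.
by rewrite /mean unlock.
Qed.

Lemma factorial_moment_distribution X r :
  factorial_moment P X r =
  (\int[distribution P X]_k ((k ^_ r)%:R : R)%:E)%E.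
Proof.
rewrite ge0_integral_distribution//.
by rewrite /factorial_moment unlock.
Qed.

Lemma gf_gw0 (xi : nat -> nat -> {RV P >-> nat}) (s : R) : 0 <= s <= 1 ->
  gf (distribution P (gw xi 0)) s = s.
Proof.
move=> s01; apply: EFin_inj; rewrite -gf_distribution//=.
by rewrite integral_cst//= [X in (_ * X)%E](probability_setT P) mule1.
Qed.

Lemma gf_cond_law_pos X (s : R) : 0 <= s <= 1 ->
  0 < gf_defect (distribution P X) 1 ->
  gf (cond_law_pos P X) s =
  1 - gf_defect (distribution P X) (1 - s) / gf_defect (distribution P X) 1.
Proof.
move=> s01; set mu : probability nat R := distribution P X.
have e01 k : 0 <= s ^+ k <= 1 by exact: expr01.
have e0 k : 0 <= s ^+ k by case/andP: (e01 k).
pose pos := [set k | (0 < k)%N].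
have posE : pos = ~` [set 0%N].
  by apply/seteqP; split=> k /=; [move=> k0 k00; rewrite k00 in k0|case: k].
have mupos : mu pos = (gf_defect mu 1)%:E.
  rewrite posE (_ : mu (~` [set 0%N]) = (1 - mu [set 0%N])%E); last exact: probability_setC.
  by rewrite /gf_defect subrr gf0 EFinB pmfE.
move=> q0.
have condE k : (cond_law_pos P X [set k] = mu (pos `&` [set k]) / mu pos)%E.
  have posP : (P [set w | (0 < X w)%N] = (gf_defect mu 1)%:E)%E by exact: mupos.
  transitivity (cond_prob P (measurable_pos X) (X @^-1` [set k])); first by [].
  by rewrite cond_probE ?posP ?lte_fin// setIC mupos.
have mupos_int : (\int[mu]_(k in pos) (s ^+ k)%:E =
    (gf_defect mu 1 * gf (cond_law_pos P X) s)%:E)%E.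
  rewrite (@ge0_integral_setI_level _ _ _ _ _ id)//.
  rewrite EFinM [gf (cond_law_pos P X) s]/gf fineK ?le1_integral_nat_fin//.
  rewrite ge0_integral_nat// -nneseriesZl; last first.
    by move=> k _; rewrite lee_fin mulr_ge0// pmf_ge0.
  apply: eq_eseriesr => k _.
  rewrite (@integral_setI_level _ _ _ _ _ id)// EFinM pmfE condE mupos.
  rewrite muleCA; congr (_ * _)%E.
  rewrite muleC -muleA inver gt_eqF//.
  by rewrite -EFinM mulVf ?mule1// gt_eqF.
(* Splitting off the value 0: on the positive integers [mu] is the conditioned law scaled by the
   survival probability [gf_defect mu 1]. *)
have muE : gf mu s = pmf mu 0 + gf_defect mu 1 * gf (cond_law_pos P X) s.
  apply: EFin_inj; rewrite EFinD -mupos_int.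
  rewrite [in LHS]/gf fineK ?le1_integral_nat_fin//.
  have -> : [set: nat] = [set 0%N] `|` pos by rewrite posE setUv.
  rewrite ge0_integral_setU//.
  - by rewrite (integral_nat_set1 mu (fun k => s ^+ k)) expr0 mul1r.
  - by move=> k _; rewrite lee_fin.
  - by rewrite posE; apply/disj_setPCl.
have -> : gf (cond_law_pos P X) s = (gf mu s - pmf mu 0) / gf_defect mu 1.
  by rewrite muE addrC addKr mulrC mulKf// gt_eqF.
have qn0 := lt0r_neq0 q0.
rewrite -gf0; apply: (mulIf qn0); rewrite divfK// mulrBl mul1r divfK//.
by rewrite /gf_defect subKr subrr; ring.
Qed.

End laws.

(** * Generating function of the geometric law *)

Section geometric.
Context {R : realType}.
Implicit Types p s : R.

Lemma gf_geometric p s : 0 < p <= 1 -> 0 <= s < 1 ->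
  gf (geometric_prob p) s = p * s / (1 - (1 - p) * s).
Proof.
move=> p01 /andP[s0 s1]; have /andP[p0 p1] := p01.
have pmfgeom k : pmf (geometric_prob p) k = geometric_pmf p k.
  rewrite /pmf /= /geometric_prob p01 esum_set1//.
  by rewrite lee_fin geometric_pmf_ge0.
rewrite /gf ge0_integral_nat; last by move=> k; exact: exprn_ge0.
rewrite -[RHS]/(fine (_)%:E); congr fine.
(* The mass at 0 vanishes, so the shifted partial sums are those of a geometric series of ratio
   [(1 - p) * s]. *)
apply/cvg_lim => //; rewrite -cvg_shiftS /=.
have -> : (fun n => \sum_(0 <= k < n.+1) (s ^+ k * pmf (geometric_prob p) k)%:E)%E =
    EFin \o series (geometric (p * s) ((1 - p) * s)).
  apply/funext => n /=; rewrite /series /= -sumEFin big_nat_recl//=.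
  rewrite pmfgeom mulr0 add0e; apply: eq_bigr => i _.
  by rewrite pmfgeom /= exprS exprMn; congr EFin; ring.
apply: cvg_EFin; first by near=> n.
apply: cvg_geometric_series.
have q0 : 0 <= (1 - p) * s by rewrite mulr_ge0// subr_ge0.
rewrite ger0_norm// (le_lt_trans _ s1)// ler_piMl//.
by rewrite gerBl ltW.
Unshelve. all: by end_near. Qed.

End geometric.

(** * Weak convergence, vanishing products and the quadratic expansion *)

Section convergence.
Context {R : realType}.

Lemma pmf_cvg_weak (mu_ : nat -> probability nat R) (mu : probability nat R) :
  (forall k, (fun n => pmf (mu_ n) k) @ \oo --> pmf mu k) ->
  weak_cvg (fun n => real_law (mu_ n)) (real_law mu).
Proof.
move=> cvgmu f cf [M [_ fM]].
have fb x : `|f x| <= M + 1 by apply: fM => //; rewrite ltrDl.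
have lawE (m : probability nat R) :
    (\int[real_law m]_x (f x)%:E = \int[m]_k (f k%:R)%:E)%E.
  rewrite integral_distribution//.
    apply/measurable_EFinP; exact: continuous_measurable_fun.
  by apply: (@bounded_integrable_nat _ m (fun k => f k%:R) (M + 1)).
rewrite lawE; under eq_fun do rewrite lawE.
by apply: (@pmf_cvg_integral _ mu_ mu (fun k => f k%:R) (M + 1)).
Qed.

(** A logarithm-free link between a divergent series and a vanishing product; with [c] the new
    factor and [s] the sum, the induction step is [0 <= (1 - c) * (1 + s - c)]. *)
Lemma prod_mul_sum_le1 (b : nat -> R) n : (forall k, 0 < b k < 1) ->
  \prod_(0 <= k < n) b k * (1 + \sum_(0 <= k < n) (1 - b k)) <= 1.
Proof.
move=> b01; elim: n => [|n IH]; first by rewrite !big_geq// addr0 mulr1.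
rewrite !big_nat_recr//=.
have p0 : 0 <= \prod_(0 <= k < n) b k.
  by apply: prodr_ge0 => k _; case/andP: (b01 k) => /ltW.
have s0 : 0 <= \sum_(0 <= k < n) (1 - b k).
  by apply: sumr_ge0 => k _; case/andP: (b01 k) => _ /ltW; rewrite subr_ge0.
move: p0 s0 IH; set p := \prod_(0 <= k < n) _; set s := \sum_(0 <= k < n) _.
move=> p0 s0 IH; have := b01 n; set c := b n => /andP[c0 c1].
apply: le_trans IH; rewrite -mulrA ler_wpM2l//.
have : 0 <= (1 - c) * (1 + s - c) by rewrite mulr_ge0//; lra.
lra.
Qed.

Lemma prod_cvg0_of_series (b : nat -> R) : (forall k, 0 < b k < 1) ->
  (forall M : R, exists n, M < \sum_(0 <= k < n) (1 - b k)) ->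
  (fun n => \prod_(0 <= k < n) b k) @ \oo --> (0 : R).
Proof.
move=> b01 sdiv; apply/cvgrPdist_le => e e0.
have [N sN] := sdiv e^-1; near=> n.
have Nn : (N <= n)%N by near: n; exact: nbhs_infty_ge.
have p0 m l : 0 <= \prod_(m <= k < l) b k.
  by apply: prodr_ge0 => k _; case/andP: (b01 k) => /ltW.
rewrite sub0r normrN ger0_norm//.
have : \prod_(0 <= k < n) b k <= \prod_(0 <= k < N) b k.
  rewrite (big_cat_nat (n := N))//= ler_piMr//.
  rewrite prodr_ile1// => k _.
  by case/andP: (b01 k) => /ltW -> /ltW ->.
move/le_trans; apply.
have := prod_mul_sum_le1 N b01.
have ei : 0 < e^-1 by rewrite invr_gt0.
set p := \prod_(0 <= k < N) _; move: sN; set s := \sum_(_ <= _ < _) _ => sN ps.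
have : p * e^-1 <= 1.
  by apply: le_trans ps; rewrite ler_wpM2l ?p0//; lra.
by rewrite ler_pdivrMr// mul1r.
Unshelve. all: by end_near. Qed.

Lemma gf_gw_hcomp d (T : measurableType d) (P : probability T R)
    (xi0 : nat -> {RV P >-> nat}) (xi : nat -> nat -> {RV P >-> nat}) n (x : R) :
  mutually_independent P [set ij : nat * nat | (0 < ij.1)%N /\ (0 < ij.2)%N]
    (fun ij => xi ij.1 ij.2) ->
  (forall n j : nat, (0 < n)%N -> (0 < j)%N ->
    distribution P (xi n j) = distribution P (xi0 n)) ->
  0 <= x <= 1 ->
  gf_defect (distribution P (gw xi n)) x =
  hcomp (fun k => gf_defect (distribution P (xi0 k))) 0 n x.
Proof.
move=> xi_indep xi_ident; elim: n x => [|n IH] x x01.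
  by rewrite /gf_defect gf_gw0 ?subKr//; lra.
rewrite hcompSr -IH add0n.
  rewrite [LHS]/gf_defect (gf_gwS xi_indep xi_ident); last lra.
  by rewrite [in RHS]/gf_defect /gf_defect subKr.
rewrite -[gf_defect _ _]/(fine (_)%:E) -gf_defectE//.
have d01 k : 0 <= 1 - (1 - x) ^+ k <= 1 by exact: onem_exp01.
by rewrite -!lee_fin fineK ?le1_integral_nat_fin// le1_integral_nat.
Qed.

(* When [nu = 0] no third moment is needed: the lower bound for the quadratic
   term is then just [gf_defect (mu n) x <= a n * x]. *)
Lemma gf_defect_expand (mu : nat -> probability nat R) (a : nat -> R) (nu : R) :
  (forall n, (0 < n)%N -> (\int[mu n]_k (k%:R : R)%:E = (a n)%:E)%E) ->
  (forall n, (0 < n)%N -> 0 < a n < 1) ->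
  0 <= nu ->
  (\int[mu n]_k ((k ^_ 2)%:R : R)%:E / (1 - (a n)%:E))%E @[n --> \oo] --> nu%:E ->
  (0 < nu -> (\int[mu n]_k ((k ^_ 3)%:R : R)%:E / (1 - (a n)%:E))%E
     @[n --> \oo] --> 0%E) ->
  forall e : R, 0 < e -> \forall n \near \oo, forall x : R, 0 < x <= 1 ->
    `|gf_defect (mu n) x - a n * x + nu / 2 * (1 - a n) * x ^+ 2| <=
    e * (1 - a n) * x ^+ 2.
Proof.
move=> mua a01 nu0 C2 C3 e e0.
have moment_near r l : (\int[mu n]_k ((k ^_ r)%:R : R)%:E / (1 - (a n)%:E))%E
      @[n --> \oo] --> l%:E ->
    \forall n \near \oo, exists2 b : R,
      (\int[mu n]_k ((k ^_ r)%:R : R)%:E = b%:E)%E &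
      `|b - l * (1 - a n)| <= e * (1 - a n).
  move=> /fine_cvgP[fin /cvgrPdist_le /(_ _ e0) near_l].
  apply: filterS3 fin near_l (nbhs_infty_gt 0) => n + + n0.
  rewrite /=.
  have a1 : 0 < 1 - a n by case/andP: (a01 n n0); lra.
  have I0 : (0 <= \int[mu n]_k ((k ^_ r)%:R : R)%:E)%E.
    by apply: integral_ge0 => k _; rewrite lee_fin.
  rewrite -EFinB inver gt_eqF//.
  case: (\int[mu n]_k ((k ^_ r)%:R : R)%:E)%E I0 => [b _ _ /= bl||//].
    exists b => //.
    have -> : b - l * (1 - a n) = - (l - b / (1 - a n)) * (1 - a n).
      by rewrite mulNr mulrBl divfK ?opprB ?gt_eqF.
    by rewrite normrM normrN (gtr0_norm a1) ler_wpM2r// ltW.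
  (* An infinite moment would make the ratio infinite, against its eventual finiteness. *)
  by move=> _; rewrite gt0_mulye ?lte_fin ?invr_gt0.
have c_near : \forall n \near \oo, 0 < nu -> exists2 c : R,
      (\int[mu n]_k ((k ^_ 3)%:R : R)%:E = c%:E)%E & `|c| <= e * (1 - a n).
  have [nup|nun] := ltP 0 nu; last first.
    by apply: nearW.
  have := moment_near 3%N 0 (C3 nup); apply: filterS => n [c cE cle] _.
  by exists c => //; rewrite mul0r subr0 in cle.
have b_near := moment_near 2%N nu C2.
apply: filterS3 b_near c_near (nbhs_infty_gt 0) => n [b bE ble] hc n0 x x01.
have x01' : 0 <= x <= 1 by case/andP: x01 => /ltW -> ->.
have x0 : 0 <= x by case/andP: x01'.
have a1 : 0 < 1 - a n by case/andP: (a01 n n0); lra.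
have up := gf_defect_le x01' (mua n n0).
have lo := gf_defect_ge x01' (mua n n0) bE.
have x2 : 0 <= x ^+ 2 by exact: sqr_ge0.
move: ble; rewrite ler_norml => /andP[ble1 ble2].
have := ler_wpM2r x2 ble1; have := ler_wpM2r x2 ble2 => bx2 bx1.
have ex2 : 0 <= e * (1 - a n) * x ^+ 2 by rewrite !mulr_ge0// ltW.
rewrite ler_norml; apply/andP; split; first lra.
have [nup|nun] := ltP 0 nu; last first.
  have -> : nu = 0 by apply/eqP; rewrite eq_le nun.
  by rewrite mul0r; lra.
have [c cE cle] := hc nup.
have up3 := gf_defect_le3 x01' (mua n n0) bE cE.
(* This turns the cubic remainder into a quadratic one. The second moment contributes at most
   [e / 2] and the third at most [e / 6] to the constant in front of [(1 - a n) * x ^+ 2]. *)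
have x3 : x ^+ 3 <= x ^+ 2 by rewrite ler_wiXn2l//; case/andP: x01'.
have c0 : 0 <= c.
  by rewrite -lee_fin -cE; apply: integral_ge0 => k _; rewrite lee_fin.
rewrite ger0_norm// in cle.
have := ler_wpM2l c0 x3; have := ler_wpM2r x2 cle.
lra.
Qed.

End convergence.

(** * Convergence of the conditioned process to the geometric law *)

Unset Implicit Arguments.

Theorem theorem1 (R : realType) (d : measure_display) (T : measurableType d)
    (P : probability T R)
    (xi0 : nat -> {RV P >-> nat}) (xi : nat -> nat -> {RV P >-> nat})
    (nu : R)
    (xi_indep : mutually_independent P
       [set ij : nat * nat | (0 < ij.1)%N /\ (0 < ij.2)%N]
       (fun ij => xi ij.1 ij.2))
    (xi_ident : forall n j : nat, (0 < n)%N -> (0 < j)%N ->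
       distribution P (xi n j) = distribution P (xi0 n))
    (mean_gt0 : forall n : nat, (0 < n)%N -> (0 < mean P (xi0 n))%E)
    (C1_lt1 : forall n : nat, (0 < n)%N -> (mean P (xi0 n) < 1)%E)
    (C1_lim : mean P (xi0 n) @[n --> \oo] --> 1%E)
    (C1_sum : (\sum_(1 <= n <oo) (1 - mean P (xi0 n)) = +oo)%E)
    (nu_ge0 : 0 <= nu)
    (C2 : (factorial_moment P (xi0 n) 2 / (1 - mean P (xi0 n)))%E
            @[n --> \oo] --> nu%:E)
    (C3 : 0 < nu ->
          (factorial_moment P (xi0 n) 3 / (1 - mean P (xi0 n)))%E
            @[n --> \oo] --> 0%E) :
  weak_cvg (fun n => real_law (cond_law_pos P (gw xi n)))
           (real_law (geometric_prob (2 / (2 + nu)))).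
Proof.
pose mu n : probability nat R := distribution P (xi0 n).
pose a n := fine (mean P (xi0 n)).
pose h n := gf_defect (mu n).
have meanE n : (0 < n)%N -> mean P (xi0 n) = (a n)%:E.
  move=> n0; rewrite /a fineK// ge0_fin_numE; last exact: ltW (mean_gt0 n n0).
  by rewrite (lt_trans (C1_lt1 n n0))// ltry.
have a01 n : (0 < n)%N -> 0 < a n < 1.
  by move=> n0; rewrite -!lte_fin -meanE// mean_gt0//= C1_lt1.
have mua n : (0 < n)%N -> (\int[mu n]_k (k%:R : R)%:E = (a n)%:E)%E.
  by move=> n0; rewrite -meanE// mean_distribution.
have h01 n (x : R) : (0 < n)%N -> 0 < x <= 1 -> 0 < h n x <= 1.
  move=> n0 x01; apply: gf_defect01 x01 _ (mua n n0).
  by case/andP: (a01 n n0).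
have h_le n (x : R) : (0 < n)%N -> 0 < x <= 1 -> h n x <= a n * x.
  move=> n0 /andP[x0 x1]; apply: gf_defect_le (mua n n0).
  by rewrite ltW.
have h_deriv0 n (y : nat -> R) : (0 < n)%N -> (forall m, 0 < y m <= 1) ->
    y @ \oo --> (0 : R) -> (fun m => h n (y m) / y m) @ \oo --> a n.
  by move=> n0; exact: gf_defect_deriv0 (mua n n0).
have ratio_cvg r (l : \bar R) :
    (factorial_moment P (xi0 n) r / (1 - mean P (xi0 n)))%E @[n --> \oo] --> l ->
    (\int[mu n]_k ((k ^_ r)%:R : R)%:E / (1 - (a n)%:E))%E @[n --> \oo] --> l.
  apply: cvg_trans; apply: near_eq_cvg; near=> n.
  rewrite factorial_moment_distribution meanE//.
  by near: n; exact: (nbhs_infty_gt 0).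
have h_expand := gf_defect_expand mua a01 nu_ge0 (ratio_cvg _ _ C2)
  (fun nu0 => ratio_cvg _ _ (C3 nu0)).
have a_cvg1 : a @ \oo --> (1 : R) by exact: fine_cvg C1_lim.
have prod_cvg0 : (fun n => \prod_(0 <= k < n) a k.+1) @ \oo --> (0 : R).
  apply: prod_cvg0_of_series => [k|M]; first exact: a01.
  (* If all partial sums were at most [M], the divergent series of (C1) would be too; its index
     starts at 1, whence [n.-1] and [a k.+1] below. *)
  apply: contrapT => /forallNP sM.
  suff : (+oo <= M%:E)%E by [].
  rewrite -C1_sum; apply: lime_le.
    apply: is_cvg_nneseries => n n1 _.
    by rewrite meanE// -EFinB lee_fin subr_ge0; case/andP: (a01 n n1) => _ /ltW.
  near=> n.
  have -> : (\sum_(1 <= k < n) (1 - mean P (xi0 k)) =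
      (\sum_(0 <= k < n.-1) (1 - a k.+1))%:E)%E.
    by rewrite -sumEFin big_add1; apply: eq_big_nat => k _; rewrite meanE.
  by rewrite lee_fin leNgt; apply/negP; exact: sM.
have v0 : 0 <= nu / 2 by rewrite divr_ge0.
have hcomp_cvg (x : R) : 0 < x <= 1 ->
    (fun n => \prod_(0 <= k < n) a k.+1 / hcomp h 0 n x) @ \oo --> x^-1 + nu / 2.
  exact: prod_div_hcomp_cvg.
have nu2 : 0 < 2 + nu by rewrite ltr_wpDr.
have p01 : 0 < 2 / (2 + nu) <= 1.
  by rewrite divr_gt0//= ler_pdivrMr// mul1r lerDl.
(* Weak convergence reduces to point masses, and these to generating functions on the open unit
   interval. *)
apply: pmf_cvg_weak; apply: gf_cvg_pmf => s /andP[s0 s1].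
have s01 : 0 <= s <= 1 by rewrite !ltW.
have x01 : 0 < 1 - s <= 1 by apply/andP; split; lra.
have u01 : 0 < (1 : R) <= 1 by rewrite ltr01 lexx.
rewrite gf_geometric ?p01//; last by rewrite ltW.
have gwE n (x : R) : 0 < x <= 1 ->
    gf_defect (distribution P (gw xi n)) x = hcomp h 0 n x.
  by move=> /andP[x0 x1]; apply: gf_gw_hcomp => //; rewrite ltW.
have hc0 n (x : R) : 0 < x <= 1 -> 0 < hcomp h 0 n x.
  by move=> /(hcomp01 h01 0 n) /andP[].
(* Both survival terms tend to 0; dividing the product of the means by each of them gives two
   sequences with finite positive limits. *)
have condE n : gf (cond_law_pos P (gw xi n)) s =
    1 - ((\prod_(0 <= k < n) a k.+1) / hcomp h 0 n 1) /
        ((\prod_(0 <= k < n) a k.+1) / hcomp h 0 n (1 - s)).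
  rewrite gf_cond_law_pos// ?gwE ?hc0//.
  have := prod_gt0 a01 0 n; rewrite add0n => p0.
  congr (_ - _); field.
  by rewrite !gt_eqF// hc0.
under eq_fun do rewrite condE.
have -> : 2 / (2 + nu) * s / (1 - (1 - 2 / (2 + nu)) * s) =
    1 - (1^-1 + nu / 2) / ((1 - s)^-1 + nu / 2).
  have t0 : 0 < 1 - s by case/andP: x01.
  have nut0 : 0 < 2 + nu * (1 - s) by rewrite ltr_wpDr// mulr_ge0// ltW.
  field.
  by rewrite !gt_eqF.
apply: cvgB; first exact: cvg_cst.
apply: cvgM; first exact: hcomp_cvg.
apply: cvgV; last exact: hcomp_cvg.
by rewrite gt_eqF// ltr_wpDr// invr_gt0; case/andP: x01.
Unshelve. all: by end_near. Qed.
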